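(* For any $n \geq 3$, any $4$-cap free, $n$-cup free configuration of size $\binom{n-1}{2}+2$ contains a pair of interweaved laced $(n-1)$-cups.
   Context: A configuration is a finite set $S$ of points with a linear order $<$ and, for every $3$-element subset, an arbitrary assignment declaring it either a cap or a cup. Points $x_1<\cdots<x_a$ form an $a$-cup (resp. $a$-cap) if every consecutive triple $\{x_{i-1},x_i,x_{i+1}\}$, $1<i<a$, is assigned cup (resp. cap); $1$- and $2$-element sets are both caps and cups. The size of a cup is its number of points; a cup $x_1\cdots x_a$ runs from (starts with) $x_1$ to (ends with) $x_a$. Two cups $C_1$, $C_2$ running from $p$ to $r$ and from $q$ to $s$ respectively are interweaved if $p<q\le r<s$. An $(n-1)$-cup $C$ from $p$ to $q$ is laced if there exist a cup $C_p$ ending with $p$ and a cup $C_q$ starting with $q$ such that $|C_p|+|C_q|=n-1$. *)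

(* Defs.v *)
From mathcomp Require Import all_boot all_order.
Set Implicit Arguments. Unset Strict Implicit. Unset Printing Implicit Defensive.

(* A configuration of size N: the points are 'I_N with their natural linear
   order; [cupf x y z] (for x < y < z) says whether the triple {x,y,z} is a
   cup (true) or a cap (false).  Values on non-increasing triples are irrelevant. *)
Definition config (N : nat) := 'I_N -> 'I_N -> 'I_N -> bool.

Fixpoint consec3 (T : Type) (P : T -> T -> T -> bool) (s : seq T) : bool :=
  match s with
  | x :: ((y :: z :: _) as t) => P x y z && consec3 P t
  | _ => true
  end.

Definition increasing N (s : seq 'I_N) : bool := sorted (fun x y : 'I_N => x < y) s.

Definition is_cup N (c : config N) (s : seq 'I_N) : bool :=
  increasing s && consec3 (fun x y z => c x y z) s.
Definition is_cap N (c : config N) (s : seq 'I_N) : bool :=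
  increasing s && consec3 (fun x y z => ~~ c x y z) s.

Definition cap_free N (c : config N) (a : nat) : Prop :=
  forall s, is_cap c s -> size s <> a.
Definition cup_free N (c : config N) (a : nat) : Prop :=
  forall s, is_cup c s -> size s <> a.

Definition runs_from_to N (C : seq 'I_N) (p q : 'I_N) : Prop :=
  ohead C = Some p /\ last p C = q.

Definition laced_cup N (c : config N) (n : nat) (C : seq 'I_N) (p q : 'I_N) : Prop :=
  [/\ is_cup c C, size C = n.-1, runs_from_to C p q &
   exists Cp Cq : seq 'I_N,
     [/\ is_cup c Cp, is_cup c Cq,
         Cp <> [::] /\ last p Cp = p,
         ohead Cq = Some q
       & size Cp + size Cq = n.-1]].

(* Main.v *)
Require Import Defs.
From mathcomp Require Import all_boot all_order zify.

Set Implicit Arguments. Unset Strict Implicit. Unset Printing Implicit Defensive.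

(* Colour an edge xy red if it is the end of some cap wxy, blue otherwise;
   4-cap-freeness turns every increasing path made of red edges followed by blue
   edges into a cup.  With m = n - 2, no such path has more than m edges, and we
   look for two interweaved paths with m edges that are laced; induct on m.  Let
   e(x) be the number of edges of a longest path ending at x.  Points on the same
   level of e are joined by red edges.  Deleting the first point of each of the m
   levels below m removes all paths with m edges, and a path with m - 1 edges from
   p that survives is prolonged by the first point z on the level of p; since
   e(z) = e(p) exceeds its value after the deletion, being laced is preserved, and
   since e increases along the starting points, so is being interweaved.  This
   works unless some v with e(v) = m starts a path with m - 1 edges.  The mirror
   image works unless some u that starts a path with m edges ends one with m - 1;
   when both u and v exist, every pair linking p to v or u to q is laced, and one
   finds such pairs with p < u <= v < q. *)

(* [redblue red S k x y]: an increasing path in [S] with [k] edges from [x] to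
   [y], a run of red edges followed by a run of blue (non-red) ones; it is grown
   from its turning vertex at both ends, so that the notion is self-dual. *)
Fixpoint redblue N (red : rel 'I_N) (S : {set 'I_N}) k (x y : 'I_N) : bool :=
  if k is k'.+1 then
    [|| (x \in S) && [exists w : 'I_N, [&& x < w, red x w & redblue red S k' w y]]
      | (y \in S) && [exists w : 'I_N, [&& w < y, ~~ red w y & redblue red S k' x w]]]
  else (x == y) && (x \in S).

Definition bounded N (red : rel 'I_N) (S : {set 'I_N}) m :=
  forall k x y, redblue red S k x y -> k <= m.

(** Counted in points, the cup has [m + 1] and the two lacing cups have [i + j + 2]; an inequality
    is enough because paths can be shortened. *)
Definition laced_path N (red : rel 'I_N) (S : {set 'I_N}) m p q :=
  redblue red S m p q /\
  exists i j p0 q0, [/\ redblue red S i p0 p, redblue red S j q q0 & m <= i + j + 1].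

Definition interweaved N (red : rel 'I_N) (S : {set 'I_N}) m :=
  exists p q r s : 'I_N,
    [/\ laced_path red S m p r, laced_path red S m q s & [/\ p < q, q <= r & r < s]].

(** * Growing, splitting and shortening paths *)

Lemma redblue_cons N (red : rel 'I_N) (S : {set 'I_N}) k (x w y : 'I_N) :
  x \in S -> x < w -> red x w -> redblue red S k w y -> redblue red S k.+1 x y.
Proof.
move=> xS xw r p /=; rewrite xS /=; apply/orP; left.
by apply/existsP; exists w; rewrite xw r p.
Qed.

Lemma redblue_rcons N (red : rel 'I_N) (S : {set 'I_N}) k (x w y : 'I_N) :
  y \in S -> w < y -> ~~ red w y -> redblue red S k x w -> redblue red S k.+1 x y.
Proof.
move=> yS wy b p /=; rewrite yS /=; apply/orP; right.
by apply/existsP; exists w; rewrite wy b p.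
Qed.

Lemma redblue0 N (red : rel 'I_N) (S : {set 'I_N}) x : x \in S -> redblue red S 0 x x.
Proof. by move=> xS; rewrite /= eqxx. Qed.

Lemma redblueS N (red : rel 'I_N) (S : {set 'I_N}) k (x y : 'I_N) :
  redblue red S k.+1 x y ->
  (exists w : 'I_N, [/\ x \in S, x < w, red x w & redblue red S k w y]) \/
  (exists w : 'I_N, [/\ y \in S, w < y, ~~ red w y & redblue red S k x w]).
Proof.
by case/orP=> /andP[uS /existsP[w /and3P[h1 h2 h3]]]; [left|right]; exists w.
Qed.

Lemma redblue_mem N (red : rel 'I_N) (S : {set 'I_N}) k (x y : 'I_N) :
  redblue red S k x y -> x \in S /\ y \in S.
Proof.
elim: k x y => [|k IH] x y; first by case/andP=> /eqP<-.
by case/redblueS=> -[w [uS _ _ /IH[]]].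
Qed.

Lemma redblue_leq N (red : rel 'I_N) (S : {set 'I_N}) k (x y : 'I_N) :
  redblue red S k x y -> x + (0 < k) <= y.
Proof.
elim: k x y => [|k IH] x y; first by case/andP=> /eqP->; rewrite addn0.
by case/redblueS=> -[w [_ lt _ /IH]] /=; lia.
Qed.

Lemma redblue_sub N (red : rel 'I_N) (S S' : {set 'I_N}) k (x y : 'I_N) :
  S' \subset S -> redblue red S' k x y -> redblue red S k x y.
Proof.
move=> /subsetP sub; elim: k x y => [|k IH] x y.
  by case/andP=> /eqP-> /sub; apply: redblue0.
case/redblueS=> -[w [/sub uS lt c /IH]]; first exact: redblue_cons lt c.
exact: redblue_rcons lt c.
Qed.

Lemma redblue_behead N (red : rel 'I_N) (S : {set 'I_N}) k (x y : 'I_N) :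
  redblue red S k.+1 x y -> exists z, redblue red S k z y.
Proof.
elim: k x y => [|k IH] x y pxy; first by exists y; apply/redblue0; case/redblue_mem: pxy.
case/redblueS: pxy => -[w [uS lt c p]]; first by exists w.
by have [z pz] := IH _ _ p; exists z; apply: redblue_rcons lt c pz.
Qed.

Lemma redblue_suffix N (red : rel 'I_N) (S : {set 'I_N}) i k (x y : 'I_N) :
  i <= k -> redblue red S k x y -> exists z, redblue red S i z y.
Proof.
elim: k x => [|k IH] x; first by rewrite leqn0 => /eqP-> p; exists x.
rewrite leq_eqVlt => /orP[/eqP-> p|ik p]; first by exists x.
by have [z pz] := redblue_behead p; apply: IH pz.
Qed.

(** A path whose last edge is not blue is red throughout, so it fits in front of any path starting
    at [y]. *)
Lemma redblue_last N (red : rel 'I_N) (S : {set 'I_N}) k (x y : 'I_N) :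
  redblue red S k.+1 x y ->
  (exists w : 'I_N, [/\ w < y, ~~ red w y & redblue red S k x w]) \/
  (forall j z, redblue red S j y z -> redblue red S (k.+1 + j) x z).
Proof.
elim: k x y => [|k IH] x y; case/redblueS=> -[w [uS lt c p]]; try by left; exists w.
  by right=> j z; case/andP: p => /eqP<- _; apply: redblue_cons lt c.
have [[v [vy b pv]]|p'] := IH _ _ p.
  by left; exists v; split=> //; apply: redblue_cons lt c pv.
by right=> j z /p'; apply: redblue_cons lt c.
Qed.

(** * Reversal of the order *)

(** Reversal alone would put blue before red, so the colours are exchanged too. A relation makes
    this symmetric without extensionality for [red]. *)
Definition mirrored N (red red' : rel 'I_N) (S S' : {set 'I_N}) :=
  (forall x y : 'I_N, red' x y = ~~ red (rev_ord y) (rev_ord x)) /\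
  (forall x, (x \in S') = (rev_ord x \in S)).

Lemma mirrored_sym N (red red' : rel 'I_N) (S S' : {set 'I_N}) :
  mirrored red red' S S' -> mirrored red' red S' S.
Proof. by case=> hr hS; split=> *; rewrite ?hr ?hS ?rev_ordK ?negbK. Qed.

Lemma mirrored_exists N (red : rel 'I_N) (S : {set 'I_N}) : exists red' S', mirrored red red' S S'.
Proof.
exists (fun x y => ~~ red (rev_ord y) (rev_ord x)), [set x | rev_ord x \in S].
by split=> // x; rewrite inE.
Qed.

Lemma rev_ord_ltn N (x y : 'I_N) : (rev_ord x < rev_ord y) = (y < x).
Proof. by have := ltn_ord x; have := ltn_ord y; rewrite /=; lia. Qed.

Lemma rev_ord_leq N (x y : 'I_N) : (rev_ord x <= rev_ord y) = (y <= x).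
Proof. by rewrite leqNgt rev_ord_ltn -leqNgt. Qed.

Lemma mirrored_redblue N (red red' : rel 'I_N) (S S' : {set 'I_N}) k (x y : 'I_N) :
  mirrored red red' S S' ->
  redblue red S k x y -> redblue red' S' k (rev_ord y) (rev_ord x).
Proof.
case=> hr hS; elim: k x y => [|k IH] x y.
  by case/andP=> /eqP-> yS; apply: redblue0; rewrite hS rev_ordK.
case/redblueS=> -[w [uS lt c /IH p]].
  by apply: redblue_rcons p; rewrite ?hS ?hr ?rev_ord_ltn ?rev_ordK ?negbK.
by apply: redblue_cons p; rewrite ?hS ?hr ?rev_ord_ltn ?rev_ordK.
Qed.

Lemma mirrored_bounded N (red red' : rel 'I_N) (S S' : {set 'I_N}) m :
  mirrored red red' S S' -> bounded red S m -> bounded red' S' m.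
Proof. by move=> /mirrored_sym h b k x y /(mirrored_redblue h)/b. Qed.

Lemma mirrored_interweaved N (red red' : rel 'I_N) (S S' : {set 'I_N}) m :
  mirrored red red' S S' -> interweaved red S m -> interweaved red' S' m.
Proof.
move=> h.
have flip p q : laced_path red S m p q -> laced_path red' S' m (rev_ord q) (rev_ord p).
  case=> pq [i [j [p0 [q0 [pi qj ij]]]]]; split; first exact: mirrored_redblue h pq.
  exists j, i, (rev_ord q0), (rev_ord p0).
  by split; [apply: mirrored_redblue h _..|rewrite (addnC j)].
case=> p [q [r [s [/flip pr /flip qs [pq qr rs]]]]].
exists (rev_ord s), (rev_ord r), (rev_ord q), (rev_ord p).
by rewrite !rev_ord_ltn rev_ord_leq.
Qed.

Lemma mirrored_card N (red red' : rel 'I_N) (S S' : {set 'I_N}) : mirrored red red' S S' -> #|S'| = #|S|.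
Proof.
case=> _ hS; rewrite -(card_imset _ rev_ord_inj); apply: eq_card => x.
apply/imsetP/idP => [[y yS ->]|xS]; first by rewrite -hS.
by exists (rev_ord x); rewrite ?hS rev_ordK.
Qed.

Lemma redblue_first N (red : rel 'I_N) (S : {set 'I_N}) k (x y : 'I_N) :
  redblue red S k.+1 x y ->
  (exists w : 'I_N, [/\ x < w, red x w & redblue red S k w y]) \/
  (forall j z, redblue red S j z x -> redblue red S (j + k.+1) z y).
Proof.
have [red' [S' h]] := mirrored_exists red S; have h' := mirrored_sym h.
move=> /(mirrored_redblue h)/redblue_last[[w [lt c p]]|p].
  left; exists (rev_ord w); split; first by rewrite -rev_ord_ltn rev_ordK.
    by have [-> _] := h'; rewrite rev_ordK.
  by have := mirrored_redblue h' p; rewrite rev_ordK.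
right=> j z /(mirrored_redblue h)/p/(mirrored_redblue h').
by rewrite !rev_ordK addnC.
Qed.

Lemma redblue_prefix N (red : rel 'I_N) (S : {set 'I_N}) i k (x y : 'I_N) :
  i <= k -> redblue red S k x y -> exists z, redblue red S i x z.
Proof.
have [red' [S' h]] := mirrored_exists red S.
move=> ik /(mirrored_redblue h)/(redblue_suffix ik)[z].
by move=> /(mirrored_redblue (mirrored_sym h)); rewrite rev_ordK; exists (rev_ord z).
Qed.

Lemma bounded_lt N (red : rel 'I_N) (S : {set 'I_N}) m (x y : 'I_N) :
  bounded red S m -> ~ redblue red S m.+1 x y.
Proof. by move=> b /b; rewrite ltnn. Qed.

(** * Longest paths and the deletion step *)

(** The range [k < m.+1] makes the maximum finite; under [bounded red S m] it cuts off nothing. *)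
Definition longest N (red : rel 'I_N) (S : {set 'I_N}) m (x : 'I_N) :=
  \max_(k < m.+1 | [exists p, redblue red S k p x]) k.

Lemma longest_path N (red : rel 'I_N) (S : {set 'I_N}) m (x : 'I_N) :
  x \in S -> exists p, redblue red S (longest red S m x) p x.
Proof.
move=> xS.
have x0 : [exists p, redblue red S (@ord0 m) p x].
  by apply/existsP; exists x; apply: redblue0.
rewrite /longest (bigmax_eq_arg (ord0 : 'I_m.+1) x0).
by case: arg_maxnP => // i /existsP.
Qed.

Lemma leq_longest N (red : rel 'I_N) (S : {set 'I_N}) m k (p x : 'I_N) :
  bounded red S m -> redblue red S k p x -> k <= longest red S m x.
Proof.
move=> b px; have km := b _ _ _ px.
have -> : k = @Ordinal m.+1 k km by [].
by apply: leq_bigmax_cond; apply/existsP; exists p.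
Qed.

(* The hypothesis on [v] excludes that a path of the smaller set starts on the top
   level of [longest], which keeps its first point. *)
Lemma interweaved_step N (red : rel 'I_N) (S : {set 'I_N}) m K :
  bounded red S m.+1 -> K + m.+1 <= #|S| ->
  (forall p v q k, redblue red S m.+1 p v -> redblue red S k v q -> k < m) ->
  exists S' : {set 'I_N}, [/\ K <= #|S'|, bounded red S' m &
    interweaved red S' m -> interweaved red S m.+1].
Proof.
move=> bS cS top.
pose e := longest red S m.+1.
have e_le x k p : redblue red S k p x -> k <= e x by apply: leq_longest.
have e_path x : x \in S -> exists p, redblue red S (e x) p x by apply: longest_path.
clearbody e; have e_max x : x \in S -> e x <= m.+1 by case/e_path => p /bS.
have e_blue (x y : 'I_N) : x \in S -> y \in S -> x < y -> ~~ red x y -> e x < e y.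
  by move=> xS yS xy b; have [p px] := e_path _ xS; apply: e_le (redblue_rcons yS xy b px).
pose D := [set x in S | (e x < m.+1) &&
  [forall z : 'I_N, (z \in S) && (z < x) ==> (e z != e x)]].
have DS : D \subset S by apply/subsetP => x; rewrite inE => /andP[].
have inD x : x \in S -> e x < m.+1 -> x \notin D ->
    exists z : 'I_N, [/\ z \in D, z < x & e z = e x].
  move=> xS ex xD.
  have [z0 [z0S z0x ez0]] : exists z : 'I_N, [/\ z \in S, z < x & e z = e x].
    move: xD; rewrite inE xS ex /= negb_forall => /existsP[z].
    by rewrite negb_imply negbK => /andP[/andP[? ?] /eqP ?]; exists z.
  have h : (z0 \in S) && (e z0 == e x) by rewrite z0S ez0 eqxx.
  case: (@arg_minnP _ z0 (fun z => (z \in S) && (e z == e x)) (fun z : 'I_N => z : nat) h).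
  move=> z /andP[zS /eqP ez] zmin; exists z; split=> //.
    rewrite inE zS ez ex /=; apply/forallP => w; apply/implyP => /andP[wS wz].
    by apply/eqP => ew; have := zmin w; rewrite wS ew eqxx => /(_ isT); lia.
  by have := zmin z0; rewrite z0S ez0 eqxx => /(_ isT); lia.
have red_eq (z x : 'I_N) : z \in S -> x \in S -> z < x -> e z = e x -> red z x.
  move=> zS xS zx ezx; apply: contraT => b.
  by have := e_blue _ _ zS xS zx b; rewrite ezx ltnn.
have cD : #|D| <= m.+1.
  rewrite -[m.+1]card_ord.
  apply: (@leq_card_in _ _ (fun x => inord (e x) : 'I_m.+1)) => x y.
  rewrite !inE => /and3P[xS ex /forallP xf] /and3P[yS ey /forallP yf] /(congr1 val) /=.
  rewrite !inordK // => exy; apply/val_inj/eqP.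
  rewrite eqn_leq; apply/andP; split; rewrite leqNgt; apply/negP => lt.
    by have := xf y; rewrite yS lt exy eqxx.
  by have := yf x; rewrite xS lt exy eqxx.
have sub : S :\: D \subset S := subsetDl S D.
have bS' : bounded red (S :\: D) m.
  move=> k x y pxy; have [] := redblue_mem pxy; rewrite inE => /andP[xD xS] _.
  have pS := redblue_sub sub pxy; have := bS _ _ _ pS.
  rewrite leq_eqVlt => /orP[/eqP ek|//].
  (* By [top], [x] is not on the top level, so the first point of its level can be put in front,
     giving [m.+2] edges. *)
  have ex : e x < m.+1.
    rewrite ltn_neqAle e_max // andbT; apply/eqP => ex.
    have [p px] := e_path _ xS; rewrite ex in px.
    by have := top _ _ _ _ px pS; rewrite ltnNge ek leqnSn.
  have [z [zD zx ez]] := inD _ xS ex xD; have zS := subsetP DS _ zD.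
  by have /bS := redblue_cons zS zx (red_eq _ _ zS xS zx ez) pS; rewrite ek ltnn.
exists (S :\: D); split=> //; first by rewrite cardsDS //; lia.
have ext p q : laced_path red (S :\: D) m p q ->
    exists z : 'I_N, [/\ laced_path red S m.+1 z q, z < p & e z = e p].
  move=> [pq [i [j [p0 [q0 [p0p qq0 ij]]]]]].
  have [] := redblue_mem pq; rewrite inE => /andP[pD pS] _.
  have pqS := redblue_sub sub pq.
  have ep : e p < m.+1.
    rewrite ltn_neqAle e_max // andbT; apply/eqP => ep.
    have [w wp] := e_path _ pS; rewrite ep in wp.
    by have := top _ _ _ _ wp pqS; rewrite ltnn.
  have [z [zD zp ez]] := inD _ pS ep pD; have zS := subsetP DS _ zD.
  have zr := red_eq _ _ zS pS zp ez.
  exists z; split=> //; split; first exact: redblue_cons zS zp zr pqS.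
  (* A longest path to [z] has [e p] edges. This beats the old [i], since the old path can be
     prolonged backwards by a point of [D]. *)
  have [w wz] := e_path _ zS.
  exists (e z), j, w, q0; split=> //; first exact: redblue_sub qq0.
  rewrite ez; suff: i < e p by clear -ij; lia.
  case: i p0p ij => [|i] p0p ij.
    by apply: leq_trans (e_le _ _ _ (redblue_cons zS zp zr (redblue0 red pS))).
  have [] := redblue_mem p0p; rewrite inE => /andP[p0D p0S] _.
  have p0lt : p0 < p by have := redblue_leq p0p; rewrite addn1.
  (* With [p0] on the top level, a red edge [p0 p] would give [m.+1] edges outside [D], and a blue
     one would lift [p] above the top. *)
  have ep0 : e p0 < m.+1.
    rewrite ltnNge; apply/negP => ep0.
    case r : (red p0 p).
      have p0S' : p0 \in S :\: D by rewrite inE p0D.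
      exact: bounded_lt bS' (redblue_cons p0S' p0lt r pq).
    have := leq_ltn_trans ep0 (e_blue _ _ p0S pS p0lt (negbT r)).
    by rewrite ltnNge e_max.
  have [y [yD yp0 ey]] := inD _ p0S ep0 p0D; have yS := subsetP DS _ yD.
  exact: e_le (redblue_cons yS yp0 (red_eq _ _ yS p0S yp0 ey) (redblue_sub sub p0p)).
case=> p1 [p2 [q1 [q2 [l1 l2 [p12 p2q1 q12]]]]].
have [z1 [lz1 zp1 ez1]] := ext _ _ l1; have [z2 [lz2 zp2 ez2]] := ext _ _ l2.
exists z1, z2, q1, q2; split=> //; split=> //; last by lia.
(* The edge [p1 p2] is blue: if red, it would prolong the path from [p2], which already has [m]
   edges. *)
have e12 : e z1 < e z2.
  have [[pq1 _] [pq2 _]] := (l1, l2).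
  have [p1S' _] := redblue_mem pq1; have [p2S' _] := redblue_mem pq2.
  rewrite ez1 ez2 e_blue ?(subsetP sub) //; apply/negP => r.
  exact: bounded_lt bS' (redblue_cons p1S' p12 r pq2).
have [[zq1 _] [zq2 _]] := (lz1, lz2).
have [z1S _] := redblue_mem zq1; have [z2S _] := redblue_mem zq2.
case: (ltngtP z1 z2) => // [z21|/val_inj z12]; last by rewrite z12 ltnn in e12.
case r : (red z2 z1); first by have /bS := redblue_cons z2S z21 r zq1; rewrite ltnn.
by have := e_blue _ _ z2S z1S z21 (negbT r); rewrite ltnNge ltnW.
Qed.

(** * Obstructions to deletion in both directions *)

(** Each of the two paths laces the other, together with a path without edges. *)
Lemma interweaved_at N (red : rel 'I_N) (S : {set 'I_N}) m (p v q : 'I_N) :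
  redblue red S m.+1 p v -> redblue red S m.+1 v q -> interweaved red S m.+1.
Proof.
move=> pv vq; have [[pS vS] [_ qS]] := (redblue_mem pv, redblue_mem vq).
exists p, v, v, q; split; last first.
- by have := redblue_leq pv; have := redblue_leq vq; rewrite !addn1.
- split=> //; exists m.+1, 0, p, q.
  by split; [|exact: redblue0|lia].
split=> //; exists 0, m.+1, p, q.
by split; [exact: redblue0| |lia].
Qed.

(** If [s < v], the edge [s v] contradicts [b] or [nb]. If [s = v], the path is rerouted through
    [w], its last vertex before [v], to a point after [v]. *)
Lemma redblue_beyond N (red : rel 'I_N) (S : {set 'I_N}) m (p u v q r s : 'I_N) :
  bounded red S m.+2 ->
  (forall x y z, redblue red S m.+2 x y -> ~ redblue red S m.+2 y z) ->
  redblue red S m.+1 p u -> redblue red S m.+2 u s ->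
  redblue red S m.+2 r v -> redblue red S m.+1 v q ->
  u < v /\ exists2 t : 'I_N, v < t & redblue red S m.+2 u t.
Proof.
move=> b nb pu us rv vq.
have [[uS sS] [vS qS]] := (redblue_mem us, redblue_mem vq).
have uv : u < v.
  case: ltngtP => // [vu|/val_inj e]; last by case: (nb r v s rv); rewrite -e.
  by case c: (red v u);
    [case: (bounded_lt b (redblue_cons vS vu c us))
    |case: (bounded_lt b (redblue_rcons uS vu (negbT c) rv))].
split=> //; case: (ltngtP v s) => [vs|sv|/val_inj e]; first by exists s.
  case c: (red s v); first by case: (nb _ _ _ us (redblue_cons sS sv c vq)).
  by case: (bounded_lt b (redblue_rcons vS sv (negbT c) us)).
move: us; rewrite -{}e => {s sS} us.
have [[w [wv bwv uw]]|/(_ _ _ vq)/b] := redblue_last us; last first.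
  by rewrite -{2}[m.+2]addn0 leq_add2l.
have wS := (redblue_mem uw).2.
have lt_uw : u < w by have := redblue_leq uw; rewrite addn1.
have ruw : red u w.
  apply: contraT => buw.
  by case: (bounded_lt b (redblue_rcons vS wv bwv (redblue_rcons wS lt_uw buw pu))).
have [[v1 [vv1 _ v1q]]|/(_ _ _ rv)/b] := redblue_first vq; last first.
  by rewrite -{2}[m.+2]addn0 leq_add2l.
have v1S := (redblue_mem v1q).1; have wv1 := ltn_trans wv vv1.
(* If [w v1] is red, go from [u] to [w], [v1] and on to [q]; if blue, follow the path to [w] and
   stop at [v1]. *)
case c: (red w v1).
  exists q; first by apply: leq_trans vv1 (leq_trans (leq_addr _ _) (redblue_leq v1q)).
  exact: redblue_cons uS lt_uw ruw (redblue_cons wS wv1 c v1q).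
by exists v1; rewrite // (redblue_rcons v1S wv1 (negbT c) uw).
Qed.

(** [redblue_beyond] and its mirror image give paths from [u] to beyond [v] and from before [u] to
    [v]; the paths with [m.+1] edges lace them. *)
Lemma interweaved_corner N (red : rel 'I_N) (S : {set 'I_N}) m (p u v q r s : 'I_N) :
  bounded red S m.+2 ->
  (forall x y z, redblue red S m.+2 x y -> ~ redblue red S m.+2 y z) ->
  redblue red S m.+1 p u -> redblue red S m.+2 u s ->
  redblue red S m.+2 r v -> redblue red S m.+1 v q ->
  interweaved red S m.+2.
Proof.
move=> b nb pu us rv vq.
have [uv [t vt ut]] := redblue_beyond b nb pu us rv vq.
have [red' [S' h]] := mirrored_exists red S; have h' := mirrored_sym h.
have flip k x y : redblue red S k x y -> redblue red' S' k (rev_ord y) (rev_ord x).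
  exact: mirrored_redblue.
have nb' x y z : redblue red' S' m.+2 x y -> ~ redblue red' S' m.+2 y z.
  move=> xy yz; exact: nb (mirrored_redblue h' yz) (mirrored_redblue h' xy).
have [_ [o uo ov]] := redblue_beyond (mirrored_bounded h b) nb'
  (flip _ _ _ vq) (flip _ _ _ rv) (flip _ _ _ us) (flip _ _ _ pu).
have {}ov : redblue red S m.+2 (rev_ord o) v.
  by rewrite -(rev_ordK v); apply: mirrored_redblue h' ov.
have {}uo : rev_ord o < u by rewrite -rev_ord_ltn rev_ordK.
exists (rev_ord o), u, v, t; split; last by split=> //; apply: ltnW.
  split=> //; exists 0, m.+1, (rev_ord o), q.
  by split; [apply/redblue0/(redblue_mem ov).1| |lia].
split=> //; exists m.+1, 0, p, t.
by split; [|apply/redblue0/(redblue_mem ut).2|lia].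
Qed.

(** * The induction *)

Lemma exists_interweaved N (red : rel 'I_N) (S : {set 'I_N}) m :
  bounded red S m.+1 -> 'C(m.+2, 2) + 2 <= #|S| -> interweaved red S m.+1.
Proof.
elim: m red S => [|m IH] red S b cS.
  (* Any single edge is a path laced by its own end points, so ['C(2, 2) + 2 = 3] points suffice. *)
  have edge (x y : 'I_N) : x \in S -> y \in S -> x < y -> laced_path red S 1 x y.
    move=> xS yS xy; split; last first.
      by exists 0, 0, x, y; rewrite !redblue0.
    case c: (red x y); first exact: redblue_cons xS xy c (redblue0 _ yS).
    exact: redblue_rcons yS xy (negbT c) (redblue0 _ xS).
  have three (x y z : 'I_N) : x \in S -> y \in S -> z \in S -> x < y -> y < z ->
      interweaved red S 1.
    by move=> xS yS zS xy yz; exists x, y, y, z; split=> //; apply: edge.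
  have /card_gt2P[x [y [z [[xS yS zS] [xy yz zx]]]]] : 2 < #|S| by apply: leq_trans cS.
  move: xy yz zx; rewrite -!val_eqE /= => xy yz zx.
  case: (ltngtP x y) xy => // xy _; case: (ltngtP y z) yz => // yz _;
    case: (ltngtP z x) zx => // zx _.
  - by have := ltn_trans xy (ltn_trans yz zx); rewrite ltnn.
  - exact: three xS yS zS xy yz.
  - exact: three zS xS yS zx xy.
  - exact: three xS zS yS zx yz.
  - exact: three yS zS xS yz zx.
  - exact: three yS xS zS xy zx.
  - exact: three zS yS xS yz xy.
  - by have := ltn_trans zx (ltn_trans yz xy); rewrite ltnn.
(* By Pascal's rule the bound drops by [m.+2], the most that deletion removes. *)
have cS' : 'C(m.+2, 2) + 2 + m.+2 <= #|S|.
  by move: cS; rewrite (binS m.+2 1) bin1; lia.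
case: (boolP [exists x, [exists y, redblue red S m.+2 x y] && [exists z, redblue red S m.+2 z x]]).
  by case/existsP=> x /andP[/existsP[y xy] /existsP[z zx]]; apply: interweaved_at zx xy.
move=> /existsPn nex.
have nb x y z : redblue red S m.+2 x y -> ~ redblue red S m.+2 y z.
  by move=> xy yz; case/negP: (nex y); apply/andP; split; apply/existsP; [exists z|exists x].
(* Without such a [v] deletion works directly; without the [u] sought below it works in the mirror
   image. *)
case: (boolP [exists v, [exists p, redblue red S m.+2 p v] && [exists q, redblue red S m.+1 v q]]); last first.
  move=> /existsPn nv.
  have [|S' [cS1 b1]] := interweaved_step b cS'; last by apply; apply: IH.
  move=> p v q k pv vq; rewrite ltnNge; apply/negP => /redblue_prefix/(_ vq)[z vz].
  by case/negP: (nv v); apply/andP; split; apply/existsP; [exists p|exists z].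
case/existsP=> v /andP[/existsP[r rv] /existsP[q vq]].
case: (boolP [exists u, [exists s, redblue red S m.+2 u s] && [exists p, redblue red S m.+1 p u]]).
  case/existsP=> u /andP[/existsP[s us] /existsP[p pu]].
  exact: interweaved_corner b nb pu us rv vq.
move=> /existsPn nu.
have [red' [S' h]] := mirrored_exists red S; have h' := mirrored_sym h.
apply: (mirrored_interweaved h').
have b' := mirrored_bounded h b; rewrite -(mirrored_card h) in cS'.
have [|S1 [cS1 b1]] := interweaved_step b' cS'; last by apply; apply: IH.
move=> p u s k /(mirrored_redblue h') pu /(mirrored_redblue h') us.
rewrite ltnNge; apply/negP => /redblue_suffix/(_ us)[z zu].
by case/negP: (nu (rev_ord u)); apply/andP; split; apply/existsP; [exists (rev_ord p)|exists z].
Qed.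

(** * From paths back to cups *)

Lemma consec3_rcons N (c : config N) (x y : 'I_N) t :
  path (fun a b : 'I_N => a < b) x t -> consec3 c (x :: t) ->
  (forall w : 'I_N, w < last x t -> c w (last x t) y) -> consec3 c (x :: rcons t y).
Proof.
elim: t x => [//|z [|z' t] IH] x /=.
  by rewrite andbT => xz _ /(_ _ xz) ->.
by case/andP=> _ zt /andP[-> czt]; apply: IH.
Qed.

(* By 4-cap-freeness an edge [xy] that is the end of a cap can be put in front
   of any cup, while the other edges can be put behind any cup. *)
Definition cap_end N (c : config N) : rel 'I_N :=
  fun x y => [exists w : 'I_N, (w < x) && ~~ c w x y].

Lemma redblue_cup N (c : config N) (S : {set 'I_N}) k (x y : 'I_N) :
  cap_free c 4 -> redblue (cap_end c) S k x y ->
  exists t, [/\ is_cup c (x :: t), size t = k & last x t = y].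
Proof.
move=> cf; elim: k x y => [|k IH] x y; first by case/andP=> /eqP->; exists [::].
case/redblueS=> -[w [_ lt e /IH[t [/andP[inc cup] sz lst]]]].
  exists (w :: t); split=> //=; last by rewrite sz.
  rewrite /increasing /= in inc; rewrite /is_cup /increasing /= lt inc /=.
  case: t inc cup {sz lst} => [//|z t] /= /andP[wz _] ->; rewrite andbT.
  (* If [x w z] were a cap, the cap [v x w] that makes [x w] red would extend to a 4-cap. *)
  apply: contraT => nc; case/existsP: e => v /andP[vx vc].
  have := cf [:: v; x; w; z]; rewrite /is_cap /increasing /= vx lt wz vc nc.
  by move=> /(_ isT).
exists (rcons t y); split; rewrite ?size_rcons ?sz ?last_rcons //.
rewrite /is_cup /increasing /= rcons_path lst lt /= andbT -/(increasing (x :: t)).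
apply/andP; split; first exact: inc.
apply: consec3_rcons => // v; rewrite lst => vw.
by move: e; rewrite negb_exists => /forallP/(_ v); rewrite vw /= negbK.
Qed.

Theorem theorem5p10 (n : nat) (c : config ('C(n.-1, 2) + 2)) :
  3 <= n -> cap_free c 4 -> cup_free c n ->
  exists (C1 C2 : seq 'I_('C(n.-1, 2) + 2)) (p q r s : 'I_('C(n.-1, 2) + 2)),
    [/\ laced_cup c n C1 p r, laced_cup c n C2 q s &
        (p < q)%N /\ (q <= r)%N /\ (r < s)%N].
Proof.
case: n c => [|[|[|m]]] // c _ cap4 cupn.
pose red := cap_end c.
have cupP k x y := @redblue_cup _ c setT k x y cap4.
have b : bounded red setT m.+1.
  move=> k x y xy; rewrite leqNgt; apply/negP => /redblue_suffix/(_ xy)[z zy].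
  have [t [cup sz _]] := cupP _ _ _ zy.
  by have := cupn _ cup; rewrite /= sz.
have laced p q : laced_path red setT m.+1 p q -> exists C, laced_cup c m.+3 C p q.
  case=> pq [i [j [p0 [q0 [p0p qq0 ij]]]]].
  have [t [cup sz lst]] := cupP _ _ _ pq.
  (* The side paths are shortened to [m] edges in total, that is, [m.+2] points. *)
  have [p1 p1p] := redblue_suffix (geq_minl i m) p0p.
  have jm : m - minn i m <= j by lia.
  have [q1 qq1] := redblue_prefix jm qq0.
  have [tp [cupp szp lstp]] := cupP _ _ _ p1p.
  have [tq [cupq szq _]] := cupP _ _ _ qq1.
  exists (p :: t); split=> //; first by rewrite /= sz.
  exists (p1 :: tp), (q :: tq); split=> //.
  by rewrite /= szp szq; lia.
have [|p [q [r [s [/laced[C1 l1] /laced[C2 l2] [pq qr rs]]]]]] := exists_interweaved b.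
  by rewrite cardsT card_ord.
by exists C1, C2, p, q, r, s.
Qed.
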